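(* Let $K_{r,s}$ denote the complete bipartite graph with parts of sizes $r$ and $s$. Then: (i) for every $s\geq 1$, $\mathrm{lec}(K_{1,s})=s$; (ii) if $2\leq s\leq r\leq 2^s$, then $\mathrm{lec}(K_{r,s})=2$; (iii) for all other $r\geq s\geq 1$ (i.e. $s\geq 2$ and $r>2^s$), $\mathrm{lec}(K_{r,s})=3$.
   Context: Given an edge-colouring $\varphi:E(G)\to[1,k]$ of a connected simple graph $G$, a path is loose if it consists of exactly one edge, or of exactly two edges of different colours, or has at least three edges coloured with at least three distinct colours. $G$ is loose edge-connected under $\varphi$ if every two distinct vertices are joined by a loose path; the loose edge-connection number $\mathrm{lec}(G)$ is the least $k$ for which such a colouring exists. *)

(* Defs.v *)
From mathcomp Require Import all_boot.

Set Implicit Arguments.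
Unset Strict Implicit.
Unset Printing Implicit Defensive.

Record sgraph := SGraph {
  vertex :> finType;
  adj : rel vertex;
  adj_sym : symmetric adj;
  adj_irrefl : irreflexive adj
}.

Definition edges (G : sgraph) : {set {set G}} :=
  [set [set u.1; u.2] | u : G * G & adj u.1 u.2].

(* The values of phi outside [edges G] are irrelevant: a path only meets
   elements of [edges G]. *)
Definition edge_colouring (G : sgraph) (k : nat) (phi : {set G} -> nat) : Prop :=
  forall e, e \in edges G -> 1 <= phi e <= k.

(* Here and below a path with vertices x, p_0, ..., p_(n-1) is given by its
   first vertex x and the sequence p of the others. *)
Definition is_path (G : sgraph) (x y : G) (p : seq G) : Prop :=
  [/\ path (@adj G) x p, uniq (x :: p) & last x p = y].

Definition path_edges (G : sgraph) (x : G) (p : seq G) : seq {set G} :=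
  pairmap (fun u v => [set u; v]) x p.

Definition loose (G : sgraph) (phi : {set G} -> nat) (x : G) (p : seq G) : Prop :=
  let cs := map phi (path_edges x p) in
  [\/ size cs = 1,
      size cs = 2 /\ uniq cs |
      3 <= size cs /\ 3 <= size (undup cs)].

Definition loose_edge_connected (G : sgraph) (phi : {set G} -> nat) : Prop :=
  forall x y : G, x != y -> exists2 p, is_path x y p & loose phi x p.

Definition lec_colourable (G : sgraph) (k : nat) : Prop :=
  exists2 phi : {set G} -> nat, edge_colouring k phi & loose_edge_connected phi.

(* [is_lec G k] means lec(G) = k. It fails for every k when G is disconnected,
   so connectedness of G is not required separately. *)
Definition is_lec (G : sgraph) (k : nat) : Prop :=
  lec_colourable G k /\ forall j, lec_colourable G j -> k <= j.

Definition biadj (r s : nat) : rel ('I_r + 'I_s) :=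
  fun u v => match u, v with
             | inl _, inr _ | inr _, inl _ => true
             | _, _ => false
             end.

Lemma biadj_sym r s : symmetric (@biadj r s).
Proof. by case=> ? []. Qed.

Lemma biadj_irrefl r s : irreflexive (@biadj r s).
Proof. by case. Qed.

Definition complete_bipartite (r s : nat) : sgraph :=
  SGraph (@biadj_sym r s) (@biadj_irrefl r s).

(* Main.v *)
Require Import Defs.
From mathcomp Require Import all_boot zify.

(** With at most two colours a loose path between non-adjacent vertices has
    length two, so a loose edge-connected 2-colouring of $K_{r,s}$ is an
    $r\times s$ binary matrix with distinct rows and distinct columns.  Such a
    matrix has at most $2^s$ rows, and for $s\le r\le 2^s$ one is obtained by
    taking the unit vectors among the rows.  For $r>2^s$ a third colour
    suffices: give one row colour 3 throughout, and in the other rows give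
    colour 1 to the first column and colour 2 to the remaining ones; vertices
    not separated by a path of length two are joined by a path of length four
    through the first column and the exceptional row. *)

Set Implicit Arguments.
Unset Strict Implicit.
Unset Printing Implicit Defensive.

Section LooseGraph.

Variable G : sgraph.
Implicit Types (phi : {set G} -> nat) (x y z : G).

Lemma edgesP (e : {set G}) :
  reflect (exists x y, adj x y /\ e = [set x; y]) (e \in edges G).
Proof.
apply: (iffP imsetP) => [[[x y]]|[x [y [xy ->]]]].
  by rewrite inE /= => xy ->; exists x, y.
by exists (x, y); rewrite ?inE.
Qed.

Lemma path_edges_sub x p :
  path (@adj G) x p -> {subset path_edges x p <= edges G}.
Proof.
elim: p x => //= y p IHp x /andP[xy yp] e; rewrite inE => /orP[/eqP->|].
  by apply/edgesP; exists x, y.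
exact: IHp.
Qed.

Lemma path_colours_bound k phi x p : edge_colouring k phi ->
  path (@adj G) x p -> size (undup (map phi (path_edges x p))) <= k.
Proof.
move=> col xp; rewrite -[leqRHS](size_iota 1); apply: uniq_leq_size.
  exact: undup_uniq.
move=> c; rewrite mem_undup => /mapP[e /(path_edges_sub xp) /col ek ->].
by rewrite mem_iota add1n ltnS.
Qed.

Lemma loose_path2 phi x z y : x != y -> adj x z -> adj z y ->
  phi [set x; z] != phi [set z; y] ->
  exists2 p, is_path x y p & loose phi x p.
Proof.
move=> xy xz zy ne; exists [:: z; y].
  split; rewrite //= ?xz ?zy // !inE orbC negb_or xy /=.
  by apply/and3P; split=> //; apply/eqP => eq; move: xz zy; rewrite eq adj_irrefl.
by apply: Or32; rewrite /= inE ne.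
Qed.

(** Non-adjacency excludes a single edge, and a path of the third kind would need three distinct
    colours out of at most two. *)
Lemma few_colours_loose k phi x y : edge_colouring k phi ->
  loose_edge_connected phi -> k <= 2 -> x != y -> ~~ adj x y ->
  exists z, [/\ adj x z, adj z y & phi [set x; z] != phi [set z; y]].
Proof.
move=> col lec k2 xy nxy; have [p [xp _ lastp]] := lec x y xy.
rewrite /loose size_map; case=> [sz|[sz un]|[_ sz]].
- by case: p sz xp lastp nxy => [|z []] //= _ /andP[+ _] <- => ->.
- case: p sz un xp lastp => [|z [|t []]] //= _.
  by rewrite inE andbT => ne /and3P[xz zt _] <-; exists z.
- by have := leq_trans sz (path_colours_bound col xp); lia.
Qed.

(** If [k] were at most 1, the two differently coloured edges of a loose path from [x] to [y] would
    both have colour 1. *)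
Lemma lec_ge2 k x y : x != y -> ~~ adj x y -> lec_colourable G k -> 2 <= k.
Proof.
move=> xy nxy [phi col lec]; rewrite leqNgt; apply/negP => k2.
have [|z [xz zy]] := few_colours_loose col lec _ xy nxy; first by lia.
have /col c1 : [set x; z] \in edges G by apply/edgesP; exists x, z.
have /col c2 : [set z; y] \in edges G by apply/edgesP; exists z, y.
by move=> /eqP; lia.
Qed.

End LooseGraph.

Lemma card_set_ord n : #|{set 'I_n}| = 2 ^ n.
Proof. by rewrite -cardsT -powersetT card_powerset cardsT card_ord. Qed.

Section Bipartite.

Variables r s : nat.
Let K := complete_bipartite r s.
Implicit Types (c : 'I_r -> 'I_s -> nat) (phi : {set K} -> nat).

Definition biedge (i : 'I_r) (j : 'I_s) : {set K} := [set (inl i : K); inr j].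

Lemma mem_biedge i j : biedge i j \in edges K.
Proof. by apply/edgesP; exists (inl i), (inr j). Qed.

Lemma edges_bipartite (e : {set K}) :
  e \in edges K -> exists i j, e = biedge i j.
Proof.
case/edgesP => -[i|j] [[i'|j']] [] // _ ->; first by exists i, j'.
by exists i', j; rewrite /biedge setUC.
Qed.

Lemma biedge_inj i j i' j' : biedge i j = biedge i' j' -> (i, j) = (i', j').
Proof.
move=> eq.
have : inl i \in biedge i' j' by rewrite -eq !inE eqxx.
have : inr j \in biedge i' j' by rewrite -eq !inE eqxx orbT.
by rewrite !inE /= orbF => /eqP[->] /eqP[->].
Qed.

(** The default 0 is taken only at sets that are not edges; on an edge the picked pair is unique by
    [biedge_inj]. *)
Definition matrix_colouring c (e : {set K}) : nat :=
  if [pick u | e == biedge u.1 u.2] is Some u then c u.1 u.2 else 0.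

Lemma matrix_colouringE c i j : matrix_colouring c (biedge i j) = c i j.
Proof.
rewrite /matrix_colouring; case: pickP => [[i' j'] /eqP/biedge_inj[-> ->] //|].
by move=> /(_ (i, j)); rewrite eqxx.
Qed.

Lemma matrix_colouringP k c : (forall i j, 1 <= c i j <= k) ->
  edge_colouring k (matrix_colouring c).
Proof.
by move=> ck e /edges_bipartite[i [j ->]]; rewrite matrix_colouringE.
Qed.

Lemma lec_bipartite phi :
  (forall i i' : 'I_r, i != i' ->
    exists2 p, @is_path K (inl i) (inl i') p & @loose K phi (inl i) p) ->
  (forall j j' : 'I_s, j != j' ->
    exists2 p, @is_path K (inr j) (inr j') p & @loose K phi (inr j) p) ->
  loose_edge_connected phi.
Proof.
move=> L R [i|j] [i'|j'] ne; [exact: L| | |exact: R].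
- by exists [:: inr j']; [split | apply: Or31].
- by exists [:: inl i']; [split | apply: Or31].
Qed.

Lemma left_loose_path2 phi i i' j : i != i' ->
  phi (biedge i j) != phi (biedge i' j) ->
  exists2 p, @is_path K (inl i) (inl i') p & @loose K phi (inl i) p.
Proof.
by move=> ne ph; apply: (@loose_path2 K _ _ (inr j)); rewrite // [X in phi _ != phi X]setUC.
Qed.

Lemma right_loose_path2 phi j j' i : j != j' ->
  phi (biedge i j) != phi (biedge i j') ->
  exists2 p, @is_path K (inr j) (inr j') p & @loose K phi (inr j) p.
Proof.
by move=> ne ph; apply: (@loose_path2 K _ _ (inl i)); rewrite // [X in phi X != _]setUC.
Qed.

Lemma lec2_rows k : k <= 2 -> lec_colourable K k -> r <= 2 ^ s.
Proof.
move=> k2 [phi col lec].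
(* Only colours 1 and 2 can occur, so the columns of colour 1 determine the whole row; equal rows
   would leave no middle vertex for a loose path. *)
pose f i := [set j | phi (biedge i j) == 1].
suff /leq_card : injective f.
  by rewrite card_set_ord card_ord.
move=> i i' /setP eq; apply/eqP; apply: contraT => ne.
have [//|//|z [+ _]] := @few_colours_loose _ _ _ (inl i : K) (inl i') col lec k2.
case: z => // j _; rewrite [X in phi _ != phi X]setUC -!/(biedge _ _).
have := eq j; rewrite !inE.
have := col _ (mem_biedge i j); have := col _ (mem_biedge i' j); lia.
Qed.

End Bipartite.

(** List all subsets of the columns with the singletons in front and let row [i] be the [i]-th set.
    The rows are then distinct, and the leading unit vectors will separate the columns. *)
Lemma singletons_first_inj r s : r <= 2 ^ s ->
  exists2 f : 'I_r -> {set 'I_s}, injective f &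
    forall (i : 'I_r) (j : 'I_s), i = j :> nat -> f i = [set j].
Proof.
move=> rs; pose S := [seq [set j] | j <- enum 'I_s].
pose L := S ++ [seq A <- enum {set 'I_s} | A \notin S].
have uS : uniq S by rewrite map_inj_uniq ?enum_uniq //; apply: set1_inj.
have uL : uniq L.
  rewrite cat_uniq uS filter_uniq ?enum_uniq //= andbT.
  by apply/hasPn => A; rewrite mem_filter => /andP[].
have sL : size L = 2 ^ s.
  have -> : size L = size (enum {set 'I_s}).
    apply/eqP; rewrite -uniq_size_uniq ?enum_uniq // => A.
    by rewrite mem_cat mem_filter mem_enum andbT orbN.
  by rewrite -cardE card_set_ord.
exists (fun i => nth set0 L i) => [i i' /eqP|i j ij].
  by rewrite nth_uniq ?sL ?(leq_trans _ rs) // => /eqP/val_inj.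
rewrite /L nth_cat size_map size_enum_ord ij ltn_ord (nth_map j) ?size_enum_ord //.
by rewrite nth_ord_enum.
Qed.

Lemma lec_bipartite2 r s : s <= r -> r <= 2 ^ s ->
  lec_colourable (complete_bipartite r s) 2.
Proof.
move=> sr /singletons_first_inj[f f_inj f1].
exists (matrix_colouring (r := r) (s := s) (fun i j => (j \in f i).+1)).
  by apply: matrix_colouringP => i j; case: (j \in _).
apply: lec_bipartite => [i i' ne|j j' ne].
- have [j neq] : exists j, (j \in f i) != (j \in f i').
    apply/existsP; apply: contraR ne; rewrite negb_exists => /forallP eq.
    by apply/eqP/f_inj/setP => j; apply/eqP; rewrite -[_ == _]negbK.
  apply: (left_loose_path2 (j := j)) => //; rewrite !matrix_colouringE.
  by case: (j \in f i) (j \in f i') neq => [] [].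
(* Row [j], which exists since [s <= r], is the unit vector at [j]: it has colour 2 in column [j]
   and 1 in column [j']. *)
- apply: (right_loose_path2 (i := (widen_ord sr j))) => //.
  rewrite !matrix_colouringE (f1 _ j) // !inE eqxx.
  by rewrite [j' == j]eq_sym (negPf ne).
Qed.

Lemma lec_bipartite3 r s : 2 <= r -> 2 <= s ->
  lec_colourable (complete_bipartite r s) 3.
Proof.
case: r s => [|[|r]] // [|[|s]] // _ _.
set K := complete_bipartite _ _.
pose c (i : 'I_r.+2) (j : 'I_s.+2) := if i == ord0 then 3 else if j == ord0 then 1 else 2.
have cE i j := matrix_colouringE c i j.
exists (matrix_colouring c).
  by apply: matrix_colouringP => i j; rewrite /c; case: ifP => // _; case: ifP.
have cE' i j : matrix_colouring c [set (inr j : K); inl i] = c i j.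
  by rewrite setUC cE.
apply: lec_bipartite => [i i' ne|j j' ne].
- have [i0|i0] := eqVneq i ord0; last have [i'0|i'0] := eqVneq i' ord0.
  + apply: (left_loose_path2 (j := ord0)) => //; rewrite !cE /c -i0 !eqxx.
    by rewrite [i' == i]eq_sym (negPf ne).
  + apply: (left_loose_path2 (j := ord0)) => //; rewrite !cE /c -i'0 !eqxx.
    by rewrite (negPf ne).
  (* The colours along this path are 1, 3, 3, 2; the column [ord_max] differs from [ord0] because
     there are at least two columns. *)
  + exists [:: inr ord0; inl ord0; inr ord_max; inl i'].
      by split=> //=; rewrite !inE !(inj_eq inl_inj) (negPf i0) (negPf ne) [_ == i']eq_sym (negPf i'0).
    apply: Or33; rewrite /path_edges /= ?cE' -!/(biedge _ _) !cE /c.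
    by rewrite !eqxx (negPf i0) (negPf i'0).
- have [j0|j0] := eqVneq j ord0; last have [j'0|j'0] := eqVneq j' ord0.
  + apply: (right_loose_path2 (i := ord_max)) => //; rewrite !cE /c -j0 !eqxx.
    by rewrite [j' == j]eq_sym (negPf ne).
  + apply: (right_loose_path2 (i := ord_max)) => //; rewrite !cE /c -j'0 !eqxx.
    by rewrite (negPf ne).
  (* Here [ord_max] serves as an ordinary row, and the colours are 2, 1, 3, 3. *)
  + exists [:: inl ord_max; inr ord0; inl ord0; inr j'].
      by split=> //=; rewrite !inE !(inj_eq inr_inj) (negPf j0) (negPf ne) [_ == j']eq_sym (negPf j'0).
    apply: Or33; rewrite /path_edges /= ?cE' -!/(biedge _ _) !cE /c.
    by rewrite !eqxx (negPf j0).
Qed.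

Lemma lec_star s : lec_colourable (complete_bipartite 1 s) s.
Proof.
exists (matrix_colouring (r := 1) (s := s) (fun _ j => j.+1)).
  by apply: matrix_colouringP => i j; rewrite /= ltn_ord.
apply: lec_bipartite => [i i'|j j' ne]; first by rewrite !ord1 eqxx.
by apply: (right_loose_path2 (i := ord0)) => //; rewrite !matrix_colouringE.
Qed.

(** Two leaves are joined only through the centre, so all edges must have different colours. *)
Lemma lec_star_ge s k : lec_colourable (complete_bipartite 1 s) k -> s <= k.
Proof.
move=> [phi col lec]; pose f j := phi (biedge (ord0 : 'I_1) j).
have f_inj : injective f.
  move=> j j' eq; apply/eqP; apply: contraT => ne.
  have [p [jp up lastp] lp] := lec (inr j) (inr j') ne.
  (* Sides alternate, so a path with more than two edges would visit the single centre twice. *)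
  case: p jp up lastp lp => [|[i|?] [|[?|t] [|[i'|?] p]]] //=.
  - by move=> _ _ [jj']; rewrite jj' eqxx in ne.
  - move=> _ _ [->]; case=> [//|[_]|[//]].
    by rewrite /= inE andbT (ord1 i) [X in phi X]setUC -/(biedge _ _) -!/(f _) eq eqxx.
  - by rewrite (ord1 i) (ord1 i') !inE eqxx !orbT /= andbF.
rewrite -[leqLHS]size_enum_ord -(size_map f) -[leqRHS](size_iota 1).
apply: uniq_leq_size => [|_ /mapP[j _ ->]].
  by rewrite map_inj_uniq ?enum_uniq.
by rewrite mem_iota add1n ltnS; apply/col/mem_biedge.
Qed.

Lemma lec_bipartite_ge2 r s k : 2 <= r ->
  lec_colourable (complete_bipartite r s) k -> 2 <= k.
Proof.
case: r => [|[|r]] // _.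
exact: (@lec_ge2 (complete_bipartite r.+2 s) _ (inl ord0) (inl ord_max)).
Qed.

Theorem theorem3 :
  [/\ forall s : nat, 1 <= s -> is_lec (complete_bipartite 1 s) s,
      forall r s : nat, 2 <= s -> s <= r -> r <= 2 ^ s ->
        is_lec (complete_bipartite r s) 2
    & forall r s : nat, 2 <= s -> 2 ^ s < r ->
        is_lec (complete_bipartite r s) 3].
Proof.
split=> [s _|r s s2 sr rs|r s s2 rs].
- by split=> [|k]; [apply: lec_star | apply: lec_star_ge].
- split=> [|k]; first exact: lec_bipartite2.
  by apply: lec_bipartite_ge2; apply: leq_trans sr.
- split=> [|k lk].
    (* The bound [2 <= r] follows from [s < 2 ^ s < r]. *)
    by apply: lec_bipartite3 => //; have := ltn_expl s (ltnSn 1); lia.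
  rewrite ltnNge; apply/negP => k2.
  by have := lec2_rows k2 lk; rewrite leqNgt rs.
Qed.
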